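(* The theory CC$'$ weakly interprets intuitionistic ${\rm Comp}({\rm PF}_{\mathcal T})+{\rm D}$; that is, for every theorem $\varphi$ of intuitionistic ${\rm Comp}({\rm PF}_{\mathcal T})+{\rm D}$ there is a theorem $\psi$ of CC$'$ such that deleting every occurrence of $\Box$ from $\psi$ yields $\varphi$ (where each term $\{x:\Box A(x)\}$ of CC$'$ becomes $\{x:A(x)\}$).
   Context: CC is the following system. Its language is the language of set theory ($\in$, $=$) augmented by a unary operator $\Box$, with formulas closed under $\wedge,\vee,\to,\forall,\exists$ and under $A\mapsto\Box A$; $\bot$ abbreviates $(\forall x)(\forall y)(x\in y)$ and $\neg A$ abbreviates $A\to\bot$. Its axioms and rules are those of intuitionistic predicate calculus with equality, plus: $A\to\Box A$; $\Box(A\wedge B)\leftrightarrow(\Box A\wedge\Box B)$; $\Box(A\vee B)\leftrightarrow(\Box A\vee\Box B)$; $\Box((\exists x)A)\leftrightarrow(\exists x)\Box A$; $\Box((\forall x)A)\leftrightarrow(\forall x)\Box A$; $\Box(A\to B)\to(\Box A\to\Box B)$; the rule ''from $\Box A$ infer $A$''; extensionality $x=y\leftrightarrow(\forall u)(u\in x\leftrightarrow u\in y)$; and the comprehension scheme $(\exists x)(\forall r)(r\in x\leftrightarrow\Box A)$ for a fixed variable $r$, any variable $x$, and any formula $A$ in which $x$ is not free. CC$'$ is the extension of CC by definitions obtained by recursively adding, for every formula $A$ (of the extended language) and variable $x$, a term $\{x:\Box A(x)\}$ whose free variables are those of $A$ other than $x$, together with the axiom $y\in\{x:\Box A(x)\}\leftrightarrow\Box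 A(y)$ for every variable $y$. ${\rm Comp}({\rm PF}_{\mathcal T})+{\rm D}$ is the positive set theory whose language is that of set theory augmented by terms generated as follows: every variable is a term; if $s,t$ are terms then $s\in t$ and $s=t$ are positive formulas; if $A,B$ are positive formulas then so are $A\wedge B$, $A\vee B$, $(\forall x)A$, $(\exists x)A$; if $A$ is a positive formula and $x$ a variable then $\{x:A(x)\}$ is a term whose free variables are those of $A$ other than $x$. Its axioms are the comprehension scheme $y\in\{x:A(x)\}\leftrightarrow A(y)$ for positive formulas $A$ and variables $x,y$, and the axiom D: $(\exists x)(\exists y)(x\neq y)$. ''Intuitionistic'' means it is taken over intuitionistic predicate logic with equality (with $x\neq y$ meaning $x=y\to\bot$). *)

(* Defs.v *)
(* pure syntax and Hilbert-style derivability.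
   Variables are de Bruijn indices; binders: All, Ex, and the comprehension
   term former [cmp A] (which binds index 0 of A). *)

(* One syntax serves both languages.
   - In CC' : [cmp A] denotes the term {x : Box A(x)}; all formulas allowed.
   - In Comp(PF_T)+D : [cmp A] denotes the term {x : A(x)}; only Box-free
     formulas whose comprehension bodies are positive are allowed
     (predicate [pf_fm] below). *)
Inductive tm : Type :=
| var : nat -> tm
| cmp : fm -> tm
with fm : Type :=
| Mem : tm -> tm -> fm
| Eq  : tm -> tm -> fm
| And : fm -> fm -> fm
| Or  : fm -> fm -> fm
| Imp : fm -> fm -> fm
| All : fm -> fm
| Ex  : fm -> fm
| Box : fm -> fm.

Definition up_ren (r : nat -> nat) : nat -> nat :=
  fun n => match n with 0 => 0 | S k => S (r k) end.

Fixpoint ren_tm (r : nat -> nat) (t : tm) : tm :=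
  match t with
  | var n => var (r n)
  | cmp A => cmp (ren_fm (up_ren r) A)
  end
with ren_fm (r : nat -> nat) (A : fm) : fm :=
  match A with
  | Mem s t => Mem (ren_tm r s) (ren_tm r t)
  | Eq s t => Eq (ren_tm r s) (ren_tm r t)
  | And A B => And (ren_fm r A) (ren_fm r B)
  | Or A B => Or (ren_fm r A) (ren_fm r B)
  | Imp A B => Imp (ren_fm r A) (ren_fm r B)
  | All A => All (ren_fm (up_ren r) A)
  | Ex A => Ex (ren_fm (up_ren r) A)
  | Box A => Box (ren_fm r A)
  end.

Definition up_sub (s : nat -> tm) : nat -> tm :=
  fun n => match n with 0 => var 0 | S k => ren_tm S (s k) end.

Fixpoint sub_tm (s : nat -> tm) (t : tm) : tm :=
  match t with
  | var n => s n
  | cmp A => cmp (sub_fm (up_sub s) A)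
  end
with sub_fm (s : nat -> tm) (A : fm) : fm :=
  match A with
  | Mem a b => Mem (sub_tm s a) (sub_tm s b)
  | Eq a b => Eq (sub_tm s a) (sub_tm s b)
  | And A B => And (sub_fm s A) (sub_fm s B)
  | Or A B => Or (sub_fm s A) (sub_fm s B)
  | Imp A B => Imp (sub_fm s A) (sub_fm s B)
  | All A => All (sub_fm (up_sub s) A)
  | Ex A => Ex (sub_fm (up_sub s) A)
  | Box A => Box (sub_fm s A)
  end.

Definition lift (A : fm) : fm := ren_fm S A.

Definition inst (A : fm) (t : tm) : fm :=
  sub_fm (fun n => match n with 0 => t | S k => var k end) A.

Definition Bot : fm := All (All (Mem (var 1) (var 0))).
Definition Neg (A : fm) : fm := Imp A Bot.
Definition Iff (A B : fm) : fm := And (Imp A B) (Imp B A).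

Inductive LogAx : fm -> Prop :=
| ax_K A B : LogAx (Imp A (Imp B A))
| ax_S A B C : LogAx (Imp (Imp A (Imp B C)) (Imp (Imp A B) (Imp A C)))
| ax_and1 A B : LogAx (Imp (And A B) A)
| ax_and2 A B : LogAx (Imp (And A B) B)
| ax_andI A B : LogAx (Imp A (Imp B (And A B)))
| ax_or1 A B : LogAx (Imp A (Or A B))
| ax_or2 A B : LogAx (Imp B (Or A B))
| ax_orE A B C : LogAx (Imp (Imp A C) (Imp (Imp B C) (Imp (Or A B) C)))
| ax_efq A : LogAx (Imp Bot A)
| ax_allE A t : LogAx (Imp (All A) (inst A t))
| ax_exI A t : LogAx (Imp (inst A t) (Ex A))
| ax_refl t : LogAx (Eq t t)
| ax_leib A s t : LogAx (Imp (Eq s t) (Imp (inst A s) (inst A t))).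

(* Non-logical axioms of CC' (those of CC plus the defining axioms of the
   new terms). Here [cmp A] is the CC' term {x : Box A(x)}. *)
Inductive CCAx : fm -> Prop :=
| cc_box A : CCAx (Imp A (Box A))
| cc_and A B : CCAx (Iff (Box (And A B)) (And (Box A) (Box B)))
| cc_or A B : CCAx (Iff (Box (Or A B)) (Or (Box A) (Box B)))
| cc_ex A : CCAx (Iff (Box (Ex A)) (Ex (Box A)))
| cc_all A : CCAx (Iff (Box (All A)) (All (Box A)))
| cc_K A B : CCAx (Imp (Box (Imp A B)) (Imp (Box A) (Box B)))
| cc_ext m n : CCAx (Iff (Eq (var m) (var n))
                         (All (Iff (Mem (var 0) (var (S m))) (Mem (var 0) (var (S n))))))
  (* comprehension: (exists x)(forall r)(r in x <-> Box A), x not free in A;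
     A has r as index 0, its other free variables skip over x *)
| cc_comp A : CCAx (Ex (All (Iff (Mem (var 0) (var 1)) (Box (ren_fm (up_ren S) A)))))
| cc_term A n : CCAx (Iff (Mem (var n) (cmp A)) (Box (inst A (var n)))).

Inductive CCThm : fm -> Prop :=
| cc_log A : LogAx A -> CCThm A
| cc_nonlog A : CCAx A -> CCThm A
| cc_mp A B : CCThm (Imp A B) -> CCThm A -> CCThm B
| cc_genR C A : CCThm (Imp (lift C) A) -> CCThm (Imp C (All A))
| cc_exR C A : CCThm (Imp A (lift C)) -> CCThm (Imp (Ex A) C)
| cc_unbox A : CCThm (Box A) -> CCThm A.

Fixpoint pf_tm (t : tm) : Prop :=
  match t with
  | var _ => True
  | cmp A => pos_fm A
  end
with pos_fm (A : fm) : Prop :=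
  match A with
  | Mem s t => pf_tm s /\ pf_tm t
  | Eq s t => pf_tm s /\ pf_tm t
  | And A B => pos_fm A /\ pos_fm B
  | Or A B => pos_fm A /\ pos_fm B
  | Imp _ _ => False
  | All A => pos_fm A
  | Ex A => pos_fm A
  | Box _ => False
  end.

Fixpoint pf_fm (A : fm) : Prop :=
  match A with
  | Mem s t => pf_tm s /\ pf_tm t
  | Eq s t => pf_tm s /\ pf_tm t
  | And A B => pf_fm A /\ pf_fm B
  | Or A B => pf_fm A /\ pf_fm B
  | Imp A B => pf_fm A /\ pf_fm B
  | All A => pf_fm A
  | Ex A => pf_fm A
  | Box _ => False
  end.

Inductive PFAx : fm -> Prop :=
| pf_comp A n : pos_fm A -> PFAx (Iff (Mem (var n) (cmp A)) (inst A (var n)))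
| pf_D : PFAx (Ex (Ex (Neg (Eq (var 1) (var 0))))).

Inductive PFThm : fm -> Prop :=
| pf_log A : LogAx A -> pf_fm A -> PFThm A
| pf_nonlog A : PFAx A -> pf_fm A -> PFThm A
| pf_mp A B : PFThm (Imp A B) -> PFThm A -> PFThm B
| pf_genR C A : PFThm (Imp (lift C) A) -> PFThm (Imp C (All A))
| pf_exR C A : PFThm (Imp A (lift C)) -> PFThm (Imp (Ex A) C).

Fixpoint erase_tm (t : tm) : tm :=
  match t with
  | var n => var n
  | cmp A => cmp (erase_fm A)
  end
with erase_fm (A : fm) : fm :=
  match A with
  | Mem s t => Mem (erase_tm s) (erase_tm t)
  | Eq s t => Eq (erase_tm s) (erase_tm t)
  | And A B => And (erase_fm A) (erase_fm B)
  | Or A B => Or (erase_fm A) (erase_fm B)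
  | Imp A B => Imp (erase_fm A) (erase_fm B)
  | All A => All (erase_fm A)
  | Ex A => Ex (erase_fm A)
  | Box A => erase_fm A
  end.

(* Main.v *)
(* Decorate a Box-free formula by putting boxes on its atoms.  A theorem of the
   positive theory has a provable decoration with no boxes on negative atoms and
   the same number j on positive ones, but this is not preserved by modus ponens:
   the premise and the cut formula may come with different decorations.  So we
   evaluate formulas in a Kripke model instead, in which soundness includes modus
   ponens, and read off a decoration at the end.

   A world is a descending sequence g of CC' formulas, standing for the theory
   it generates, and it forces a positive formula P iff some g_j proves some
   Box^n P.  As "some n" absorbs an extra box, full comprehension for positive
   formulas holds, since y in {x : P} is equivalent to Box P(y); D holds as
   {x : x = x} = {x : Bot} implies Box Bot.  By induction on A, forcing A yields
   the decoration of A above for some j, and is implied by the family, over all j,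
   of decorations with j boxes on negative atoms and none on positive ones. *)
From Stdlib Require Import List Lia PeanoNat FunctionalExtensionality.
Require Import Defs.

Scheme tm_fm_ind := Induction for tm Sort Prop
  with fm_tm_ind := Induction for fm Sort Prop.
Combined Scheme tm_fm_mutind from tm_fm_ind, fm_tm_ind.

(** * Renamings and substitutions *)

Definition scons {X : Type} (t : X) (s : nat -> X) : nat -> X :=
  fun n => match n with 0 => t | S k => s k end.

Ltac by_cases_on_index :=
  let k := fresh in apply functional_extensionality; intros [|k]; simpl; auto.

Ltac syntax_induction :=
  apply tm_fm_mutind; simpl; intros;
  repeat match goal with
  | IH : forall _, _ |- _ => rewrite IH; clear IH
  end; auto.

Lemma ren_ren :
  (forall t r q, ren_tm q (ren_tm r t) = ren_tm (fun n => q (r n)) t) /\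
  (forall A r q, ren_fm q (ren_fm r A) = ren_fm (fun n => q (r n)) A).
Proof.
  assert (U : forall r q, (fun n => up_ren q (up_ren r n)) = up_ren (fun n => q (r n)))
    by (intros; by_cases_on_index).
  syntax_induction; rewrite ?U; auto.
Qed.

Lemma sub_ren :
  (forall t r s, sub_tm s (ren_tm r t) = sub_tm (fun n => s (r n)) t) /\
  (forall A r s, sub_fm s (ren_fm r A) = sub_fm (fun n => s (r n)) A).
Proof.
  assert (U : forall r s, (fun n => up_sub s (up_ren r n)) = up_sub (fun n => s (r n)))
    by (intros; by_cases_on_index).
  syntax_induction; rewrite ?U; auto.
Qed.

Lemma ren_sub :
  (forall t s r, ren_tm r (sub_tm s t) = sub_tm (fun n => ren_tm r (s n)) t) /\
  (forall A s r, ren_fm r (sub_fm s A) = sub_fm (fun n => ren_tm r (s n)) A).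
Proof.
  assert (U : forall s r,
    (fun n => ren_tm (up_ren r) (up_sub s n)) = up_sub (fun n => ren_tm r (s n))).
  { intros; by_cases_on_index. now rewrite !(proj1 ren_ren). }
  syntax_induction; rewrite ?U; auto.
Qed.

Lemma sub_sub :
  (forall t s q, sub_tm q (sub_tm s t) = sub_tm (fun n => sub_tm q (s n)) t) /\
  (forall A s q, sub_fm q (sub_fm s A) = sub_fm (fun n => sub_tm q (s n)) A).
Proof.
  assert (U : forall s q,
    (fun n => sub_tm (up_sub q) (up_sub s n)) = up_sub (fun n => sub_tm q (s n))).
  { intros; by_cases_on_index. now rewrite (proj1 sub_ren), (proj1 ren_sub). }
  syntax_induction; rewrite ?U; auto.
Qed.

Lemma sub_var :
  (forall t, sub_tm var t = t) /\ (forall A, sub_fm var A = A).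
Proof.
  assert (U : up_sub var = var) by by_cases_on_index.
  apply tm_fm_mutind; simpl; intros; rewrite ?U; congruence.
Qed.

Lemma ren_as_sub :
  (forall t r, ren_tm r t = sub_tm (fun n => var (r n)) t) /\
  (forall A r, ren_fm r A = sub_fm (fun n => var (r n)) A).
Proof.
  split; intros; [rewrite <- (proj1 sub_var (ren_tm r t)) | rewrite <- (proj2 sub_var (ren_fm r A))];
    apply sub_ren.
Qed.

Lemma ren_id :
  (forall t, ren_tm (fun n => n) t = t) /\ (forall A, ren_fm (fun n => n) A = A).
Proof.
  split; intros; [rewrite (proj1 ren_as_sub) | rewrite (proj2 ren_as_sub)]; apply sub_var.
Qed.

Lemma inst_sub_up s A t : inst (sub_fm (up_sub s) A) t = sub_fm (scons t s) A.
Proof.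
  unfold inst. rewrite (proj2 sub_sub). f_equal. by_cases_on_index.
  rewrite (proj1 sub_ren). apply sub_var.
Qed.

Lemma ren_inst r A t :
  ren_fm r (inst A t) = inst (ren_fm (up_ren r) A) (ren_tm r t).
Proof.
  unfold inst. rewrite (proj2 ren_sub), (proj2 sub_ren). f_equal. by_cases_on_index.
Qed.

(** Presents the body of a quantifier as an instance of its own lift, which is the form that
    [ax_allE], [ax_exI] and [cc_term] can match under a binder. *)
Lemma inst_ren_up_S_var0 A : inst (ren_fm (up_ren S) A) (var 0) = A.
Proof.
  unfold inst. rewrite (proj2 sub_ren). rewrite <- (proj2 sub_var A) at 2.
  f_equal. by_cases_on_index.
Qed.

Lemma ren_up_lift r A : ren_fm (up_ren r) (lift A) = lift (ren_fm r A).
Proof. unfold lift. now rewrite !(proj2 ren_ren). Qed.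

(** * Derivations in CC' *)

Lemma LogAx_ren r A : LogAx A -> LogAx (ren_fm r A).
Proof.
  destruct 1; simpl; rewrite ?ren_inst; constructor.
Qed.

Lemma CCAx_ren r A : CCAx A -> CCAx (ren_fm r A).
Proof.
  destruct 1; simpl; rewrite ?ren_inst; try constructor.
  replace (ren_fm (up_ren (up_ren r)) (ren_fm (up_ren S) A))
      with (ren_fm (up_ren S) (ren_fm (up_ren r) A)); [constructor|].
  rewrite !(proj2 ren_ren). f_equal. by_cases_on_index.
Qed.

(** The quantifier rules call the induction hypothesis at [up_ren r], hence the statement for all
    [r]. Transport of entailments along arrows between worlds rests on this. *)
Lemma CCThm_ren A : CCThm A -> forall r, CCThm (ren_fm r A).
Proof.
  induction 1; intros r; simpl.
  - now apply cc_log, LogAx_ren.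
  - now apply cc_nonlog, CCAx_ren.
  - eapply cc_mp; [apply (IHCCThm1 r) | apply IHCCThm2].
  - apply cc_genR. rewrite <- ren_up_lift. apply (IHCCThm (up_ren r)).
  - apply cc_exR. rewrite <- ren_up_lift. apply (IHCCThm (up_ren r)).
  - apply cc_unbox, (IHCCThm r).
Qed.

(** * Derivation from a list of hypotheses *)

(** The head of the list becomes the innermost antecedent, so that [der (A :: L) B] and
    [der L (Imp A B)] are convertible. Hypotheses stay inside a theorem, and [cc_unbox] is never
    applied under them. *)
Fixpoint imps (L : list fm) (A : fm) : fm :=
  match L with nil => A | C :: L => imps L (Imp C A) end.

Definition der (L : list fm) (A : fm) : Prop := CCThm (imps L A).

Lemma Imp_weaken A B : CCThm B -> CCThm (Imp A B).
Proof. apply cc_mp, cc_log, ax_K. Qed.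

Lemma der_thm L A : CCThm A -> der L A.
Proof.
  unfold der. revert A. induction L as [|C L IH]; simpl; auto using Imp_weaken.
Qed.

Lemma der_mp L A B : der L (Imp A B) -> der L A -> der L B.
Proof.
  unfold der. revert A B. induction L as [|C L IH]; simpl; intros A B H1 H2.
  - eapply cc_mp; eassumption.
  - refine (IH _ _ (IH _ _ _ H1) H2). apply (der_thm L), cc_log, ax_S.
Qed.

Lemma der_app L A B : CCThm (Imp A B) -> der L A -> der L B.
Proof. intros H. apply der_mp, der_thm, H. Qed.

Lemma der_hyp L A : In A L -> der L A.
Proof.
  induction L as [|C L IH]; [easy|]. intros [->|H].
  - apply (der_thm L (Imp A A)).
    apply (cc_mp (Imp A (Imp A A))); [|apply cc_log, ax_K].
    apply (cc_mp (Imp A (Imp (Imp A A) A))); [apply cc_log, ax_S | apply cc_log, ax_K].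
  - apply (der_app L A (Imp C A)); [apply cc_log, ax_K | now apply IH].
Qed.

Lemma der_intro L A B : der (A :: L) B -> der L (Imp A B).
Proof. exact (fun H => H). Qed.

Lemma der_And L A B : der L A -> der L B -> der L (And A B).
Proof.
  intros HA HB. eapply der_mp; [|exact HB].
  eapply der_app; [|exact HA]. apply cc_log, ax_andI.
Qed.

Lemma der_And1 L A B : der L (And A B) -> der L A.
Proof. apply der_app, cc_log, ax_and1. Qed.

Lemma der_And2 L A B : der L (And A B) -> der L B.
Proof. apply der_app, cc_log, ax_and2. Qed.

Lemma der_OrE L A B C : der L (Or A B) -> der (A :: L) C -> der (B :: L) C -> der L C.
Proof.
  intros HO HA HB. eapply der_mp; [|exact HO].
  eapply der_mp; [|exact HB]. eapply der_app; [|exact HA]. apply cc_log, ax_orE.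
Qed.

Lemma der_Or1 L A B : der L A -> der L (Or A B).
Proof. apply der_app, cc_log, ax_or1. Qed.

Lemma der_Or2 L A B : der L B -> der L (Or A B).
Proof. apply der_app, cc_log, ax_or2. Qed.

Lemma der_allE L A t : der L (All A) -> der L (inst A t).
Proof. apply der_app, cc_log, ax_allE. Qed.

Lemma der_exI L A t : der L (inst A t) -> der L (Ex A).
Proof. apply der_app, cc_log, ax_exI. Qed.

Ltac hyp := solve [apply der_hyp; simpl; tauto].
Ltac start := match goal with |- CCThm ?A => change (der nil A) end;
  repeat apply der_intro.

Lemma Imp_refl A : CCThm (Imp A A).
Proof. start; hyp. Qed.

Lemma Imp_trans A B C : CCThm (Imp A B) -> CCThm (Imp B C) -> CCThm (Imp A C).
Proof. intros H1 H2. start. apply (der_app _ B _ H2), (der_app _ A _ H1). hyp. Qed.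

Lemma CCThm_gen A : CCThm A -> CCThm (All A).
Proof.
  (* [cc_genR] produces an implication; a provable closed antecedent is supplied and then
     detached. *)
  intros H. apply (cc_mp (Imp Bot Bot)); [|apply Imp_refl].
  apply cc_genR, Imp_weaken, H.
Qed.

Lemma Imp_And A B A' B' :
  CCThm (Imp A A') -> CCThm (Imp B B') -> CCThm (Imp (And A B) (And A' B')).
Proof.
  intros HA HB. start. apply der_And.
  - apply (der_app _ _ _ HA). eapply der_And1; hyp.
  - apply (der_app _ _ _ HB). eapply der_And2; hyp.
Qed.

Lemma Imp_Or A B A' B' :
  CCThm (Imp A A') -> CCThm (Imp B B') -> CCThm (Imp (Or A B) (Or A' B')).
Proof.
  intros HA HB. start. eapply der_OrE; [hyp| |].
  - apply der_Or1, (der_app _ _ _ HA); hyp.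
  - apply der_Or2, (der_app _ _ _ HB); hyp.
Qed.

Lemma Imp_Imp A B A' B' :
  CCThm (Imp A' A) -> CCThm (Imp B B') -> CCThm (Imp (Imp A B) (Imp A' B')).
Proof.
  intros HA HB. start. apply (der_app _ _ _ HB).
  eapply der_mp; [hyp|]. apply (der_app _ _ _ HA); hyp.
Qed.

Lemma lift_All_body A : CCThm (Imp (lift (All A)) A).
Proof.
  rewrite <- (inst_ren_up_S_var0 A) at 2. apply cc_log, ax_allE.
Qed.

Lemma body_lift_Ex A : CCThm (Imp A (lift (Ex A))).
Proof.
  rewrite <- (inst_ren_up_S_var0 A) at 1. apply cc_log, ax_exI.
Qed.

Lemma Imp_All A B : CCThm (Imp A B) -> CCThm (Imp (All A) (All B)).
Proof. intros H. apply cc_genR. eapply Imp_trans; [apply lift_All_body | exact H]. Qed.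

Lemma Imp_Ex A B : CCThm (Imp A B) -> CCThm (Imp (Ex A) (Ex B)).
Proof. intros H. apply cc_exR. eapply Imp_trans; [exact H | apply body_lift_Ex]. Qed.

Lemma Imp_of_Iff A B : CCThm (Iff A B) -> CCThm (Imp A B).
Proof. apply (der_And1 nil). Qed.

Lemma Imp_of_Iff_sym A B : CCThm (Iff A B) -> CCThm (Imp B A).
Proof. apply (der_And2 nil). Qed.

(** * Iterated boxes and comprehension at arbitrary terms *)

Definition boxn (n : nat) (A : fm) : fm := Nat.iter n Box A.

Lemma Imp_Box A B : CCThm (Imp A B) -> CCThm (Imp (Box A) (Box B)).
Proof.
  intros H. eapply cc_mp; [apply cc_nonlog, cc_K|].
  eapply cc_mp; [apply cc_nonlog, cc_box | exact H].
Qed.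

Lemma Imp_boxn n A B : CCThm (Imp A B) -> CCThm (Imp (boxn n A) (boxn n B)).
Proof. induction n; simpl; auto using Imp_Box. Qed.

Lemma boxn_le m n A : m <= n -> CCThm (Imp (boxn m A) (boxn n A)).
Proof.
  induction 1; [apply Imp_refl|].
  eapply Imp_trans; [exact IHle | apply cc_nonlog, cc_box].
Qed.

Lemma boxn_add m n A : boxn (m + n) A = boxn m (boxn n A).
Proof. apply Nat.iter_add. Qed.

Lemma boxn_K n A B : CCThm (Imp (boxn n (Imp A B)) (Imp (boxn n A) (boxn n B))).
Proof.
  induction n; simpl; [apply Imp_refl|].
  eapply Imp_trans; [apply Imp_Box, IHn | apply cc_nonlog, cc_K].
Qed.

Lemma ren_boxn r n A : ren_fm r (boxn n A) = boxn n (ren_fm r A).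
Proof. induction n; simpl; congruence. Qed.

Lemma sub_boxn s n A : sub_fm s (boxn n A) = boxn n (sub_fm s A).
Proof. induction n; simpl; congruence. Qed.

(** The axiom speaks of variables only. It is taken at variable 0 for a renamed [A] in which that
    variable is fresh, then generalised and instantiated at [t]. *)
Lemma comprehension_term A t : CCThm (Iff (Mem t (cmp A)) (Box (inst A t))).
Proof.
  assert (H : CCThm (inst (Iff (Mem (var 0) (cmp (ren_fm (up_ren S) A))) (Box A)) t)).
  { apply (der_allE nil), CCThm_gen.
    rewrite <- (inst_ren_up_S_var0 A) at 2. apply cc_nonlog, cc_term. }
  unfold inst in H; simpl in H. rewrite (proj2 sub_ren) in H.
  replace (fun n => up_sub _ (up_ren S n)) with var in H by by_cases_on_index.
  rewrite (proj2 sub_var) in H. exact H.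
Qed.

(** * Worlds and the forcing relation *)

Definition desc (g : nat -> fm) : Prop := forall j, CCThm (Imp (g (S j)) (g j)).
Definition asc (G : nat -> fm) : Prop := forall j, CCThm (Imp (G j) (G (S j))).
(** A common index loses nothing: when [g] descends and [G] ascends, two different indices can be
    raised to their maximum ([ent_intro]). *)
Definition ent (g G : nat -> fm) : Prop := exists j, CCThm (Imp (g j) (G j)).

(** The accessibility relation: up to the renaming [r], the theory generated by [h] extends that of
    [g]. The renaming allows a later world to have fresh variables, as in [arr_lift]. *)
Definition arr (r : nat -> nat) (g h : nat -> fm) : Prop :=
  desc h /\ forall i, exists j, CCThm (Imp (h j) (ren_fm r (g i))).

Lemma desc_le g : desc g -> forall i j, i <= j -> CCThm (Imp (g j) (g i)).
Proof. intros Hg. induction 1; eauto using Imp_refl, Imp_trans. Qed.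

Lemma asc_le G : asc G -> forall i j, i <= j -> CCThm (Imp (G i) (G j)).
Proof. intros HG. induction 1; eauto using Imp_refl, Imp_trans. Qed.

Lemma ent_intro g G i j : desc g -> asc G -> CCThm (Imp (g i) (G j)) -> ent g G.
Proof.
  intros Hg HG H. exists (max i j).
  eapply Imp_trans; [apply (desc_le g Hg i); lia|].
  eapply Imp_trans; [exact H|]. apply (asc_le G HG); lia.
Qed.

Lemma asc_ren r G : asc G -> asc (fun j => ren_fm r (G j)).
Proof. intros HG j. apply (CCThm_ren _ (HG j) r). Qed.

Lemma asc_boxn A : asc (fun n => boxn n A).
Proof. intros n. apply boxn_le; lia. Qed.

Lemma arr_id g : desc g -> arr (fun n => n) g g.
Proof. split; [assumption|]. intros i. exists i. rewrite (proj2 ren_id). apply Imp_refl. Qed.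

Lemma arr_comp r q g h k : arr r g h -> arr q h k -> arr (fun n => q (r n)) g k.
Proof.
  intros [_ H1] [Hk H2]. split; [assumption|]. intros i.
  destruct (H1 i) as [j Hj]. destruct (H2 j) as [l Hl]. exists l.
  eapply Imp_trans; [exact Hl|].
  generalize (CCThm_ren _ Hj q). simpl. now rewrite (proj2 ren_ren).
Qed.

Lemma ent_arr r g h G : asc G -> arr r g h -> ent g G -> ent h (fun j => ren_fm r (G j)).
Proof.
  intros HG [Hh H] [j Hj]. destruct (H j) as [i Hi].
  apply (ent_intro _ _ i j Hh (asc_ren r G HG)).
  eapply Imp_trans; [exact Hi|]. apply (CCThm_ren _ Hj r).
Qed.

(** For descending sequences, conjoining equal indices already generates the join of the two
    theories. *)
Definition extend (g C : nat -> fm) : nat -> fm := fun j => And (g j) (C j).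

Lemma desc_extend g C : desc g -> desc C -> desc (extend g C).
Proof. intros Hg HC j. apply Imp_And; auto. Qed.

Lemma arr_extend g C : desc g -> desc C -> arr (fun n => n) g (extend g C).
Proof.
  split; [now apply desc_extend|]. intros i. exists i.
  rewrite (proj2 ren_id). apply cc_log, ax_and1.
Qed.

Lemma desc_lift g : desc g -> desc (fun j => lift (g j)).
Proof. intros Hg j. apply (CCThm_ren _ (Hg j) S). Qed.

Lemma arr_lift g : desc g -> arr S g (fun j => lift (g j)).
Proof. split; [now apply desc_lift|]. intros i. exists i. apply Imp_refl. Qed.

(** * Environments, covers and forcing *)

Definition env : Type := nat -> tm.
Definition ren_env (r : nat -> nat) (s : env) : env := fun n => ren_tm r (s n).

Lemma ren_env_id s : ren_env (fun n => n) s = s.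
Proof. apply functional_extensionality; intros n. apply ren_id. Qed.

Lemma ren_env_comp r q s : ren_env q (ren_env r s) = ren_env (fun n => q (r n)) s.
Proof. apply functional_extensionality; intros n. apply ren_ren. Qed.

Lemma ren_env_scons r t s : ren_env r (scons t s) = scons (ren_tm r t) (ren_env r s).
Proof. by_cases_on_index. Qed.

(* Quantifying over all goals [G] replaces the choice of a disjunct or of a
   witness, which a world need not make. *)
Definition cov (g : nat -> fm) (X : (nat -> nat) -> (nat -> fm) -> Prop) : Prop :=
  forall r h G, arr r g h -> asc G ->
  (forall q k, arr q h k -> X (fun n => q (r n)) k -> ent k (fun j => ren_fm q (G j))) ->
  ent h G.

Fixpoint forces (A : fm) (g : nat -> fm) (s : env) : Prop :=
  match A with
  | Mem t u => ent g (fun n => boxn n (sub_fm s (Mem t u)))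
  | Eq t u => ent g (fun n => boxn n (sub_fm s (Eq t u)))
  | And A B => forces A g s /\ forces B g s
  | Or A B => cov g (fun r h => forces A h (ren_env r s) \/ forces B h (ren_env r s))
  | Imp A B => forall r h, arr r g h -> forces A h (ren_env r s) -> forces B h (ren_env r s)
  | All A => forall r h t, arr r g h -> forces A h (scons t (ren_env r s))
  | Ex A => cov g (fun r h => exists t, forces A h (scons t (ren_env r s)))
  | Box A => forces A g s
  end.

Lemma cov_arr r g h X :
  arr r g h -> cov g X -> cov h (fun q k => X (fun n => q (r n)) k).
Proof.
  intros Hr HX q k G Hq HG H. apply (HX _ k G (arr_comp _ _ _ _ _ Hr Hq) HG).
  exact H.
Qed.

Lemma cov_impl g (X Y : (nat -> nat) -> (nat -> fm) -> Prop) :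
  (forall r h, arr r g h -> X r h -> Y r h) -> cov g X -> cov g Y.
Proof.
  intros HXY HX r h G Hr HG H. apply (HX r h G Hr HG). intros q k Hq Hx.
  apply (H q k Hq), HXY; [exact (arr_comp _ _ _ _ _ Hr Hq) | exact Hx].
Qed.

Lemma cov_unit g (X : (nat -> nat) -> (nat -> fm) -> Prop) :
  (forall r h, arr r g h -> X r h) -> cov g X.
Proof.
  intros HX r h G Hr HG H.
  assert (Hh : desc h) by apply Hr.
  specialize (H _ h (arr_id h Hh) (HX r h Hr)). destruct H as [j Hj].
  rewrite (proj2 ren_id) in Hj. now exists j.
Qed.

(** With [cov_unit] and [cov_impl] this makes [cov] a monad. The goal of the outer cover,
    transported along [q], serves as the goal of the inner one. *)
Lemma cov_join g X :
  cov g (fun r h => cov h (fun q k => X (fun n => q (r n)) k)) -> cov g X.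
Proof.
  intros HX r h G Hr HG H. apply (HX r h G Hr HG). intros q k Hq Hk.
  assert (Hd : desc k) by apply Hq.
  apply (Hk _ k _ (arr_id k Hd) (asc_ren q G HG)).
  intros p l Hp Hl. destruct (H _ l (arr_comp _ _ _ _ _ Hq Hp) Hl) as [j Hj].
  exists j. now rewrite (proj2 ren_ren).
Qed.

(** Persistence. Atoms survive by [ent_arr]; the clauses for [Imp], [All] and [cov] already range
    over all later worlds, so composing arrows suffices. *)
Lemma forces_arr A : forall r g h s,
  arr r g h -> forces A g s -> forces A h (ren_env r s).
Proof.
  induction A; simpl; intros r g h s Hr H.
  1,2: destruct (ent_arr r g h _ (asc_boxn _) Hr H) as [j Hj]; exists j;
    rewrite ren_boxn in Hj; simpl in Hj; rewrite !(proj1 ren_sub) in Hj; exact Hj.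
  - destruct H; eauto.
  - generalize (cov_arr _ _ _ _ Hr H). apply cov_impl. intros q k _.
    now rewrite ren_env_comp.
  - intros q k Hq. rewrite ren_env_comp. apply H. eapply arr_comp; eassumption.
  - intros q k t Hq. rewrite ren_env_comp. apply H. eapply arr_comp; eassumption.
  - generalize (cov_arr _ _ _ _ Hr H). apply cov_impl. intros q k _.
    now rewrite ren_env_comp.
  - eauto.
Qed.

(** Locality: forcing descends from a cover. This is what validates the elimination of [Or] and
    [Ex], whose forcing provides a disjunct or a witness only on a cover. *)
Lemma forces_cov A : forall g s,
  desc g -> cov g (fun r h => forces A h (ren_env r s)) -> forces A g s.
Proof.
  induction A; simpl; intros g s Hg H.
  (* The goal handed to the cover is the sequence of boxed copies of the atom itself. *)
  1,2: apply (H (fun n => n) g _ (arr_id g Hg) (asc_boxn _));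
    intros q k Hq [j Hj]; exists j; rewrite ren_boxn; simpl;
    rewrite !(proj1 ren_sub); exact Hj.
  - split; [apply IHA1 | apply IHA2]; auto;
      revert H; apply cov_impl; tauto.
  - apply cov_join. revert H. apply cov_impl. intros r h _. apply cov_impl.
    intros q k _. now rewrite ren_env_comp.
  - intros r h Hr HA. apply IHA2; [apply Hr|].
    generalize (cov_arr _ _ _ _ Hr H). apply cov_impl. intros q k Hq HI.
    rewrite ren_env_comp. rewrite <- (ren_env_id (ren_env (fun n => q (r n)) s)).
    apply HI; [apply arr_id, Hq|]. rewrite ren_env_id, <- ren_env_comp.
    eapply forces_arr; eassumption.
  - intros r h t Hr. apply IHA; [apply Hr|].
    generalize (cov_arr _ _ _ _ Hr H). apply cov_impl. intros q k Hq HI.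
    rewrite ren_env_scons, ren_env_comp.
    rewrite <- (ren_env_id (ren_env (fun n => q (r n)) s)).
    apply HI, arr_id, Hq.
  - apply cov_join. revert H. apply cov_impl. intros r h _. apply cov_impl.
    intros q k _. now rewrite ren_env_comp.
  - auto.
Qed.

Definition comp_env (s q : nat -> tm) : env := fun n => sub_tm s (q n).

Lemma comp_env_ren r s q : comp_env (ren_env r s) q = ren_env r (comp_env s q).
Proof.
  apply functional_extensionality; intros n. symmetry. apply ren_sub.
Qed.

Lemma comp_env_scons t s q : comp_env (scons t s) (up_sub q) = scons t (comp_env s q).
Proof. by_cases_on_index. unfold comp_env; simpl. now rewrite (proj1 sub_ren). Qed.

Lemma forces_sub A : forall q g s,
  forces (sub_fm q A) g s <-> forces A g (comp_env s q).
Proof.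
  induction A; simpl; intros q g s.
  1,2: now rewrite !(proj1 sub_sub).
  - now rewrite IHA1, IHA2.
  - split; apply cov_impl; intros r h _; rewrite IHA1, IHA2, comp_env_ren; auto.
  - split; intros H r h Hr; specialize (H r h Hr); revert H;
      rewrite IHA1, IHA2, comp_env_ren; auto.
  - split; intros H r h t Hr; specialize (H r h t Hr); revert H;
      rewrite IHA, comp_env_scons, comp_env_ren; auto.
  - split; apply cov_impl; intros r h _ [t H]; exists t; revert H;
      rewrite IHA, comp_env_scons, comp_env_ren; auto.
  - apply IHA.
Qed.

Lemma forces_inst A t g s :
  forces (inst A t) g s <-> forces A g (scons (sub_tm s t) s).
Proof.
  unfold inst. rewrite forces_sub.
  replace (comp_env s _) with (scons (sub_tm s t) s); [reflexivity|].
  by_cases_on_index.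
Qed.

Lemma forces_lift A t g s : forces (lift A) g (scons t s) <-> forces A g s.
Proof.
  unfold lift. rewrite (proj2 ren_as_sub), forces_sub.
  replace (comp_env _ _) with s; [reflexivity|].
  now apply functional_extensionality.
Qed.

(** * Decorations *)

(* [m] boxes on the atoms in negative, [n] boxes on those in positive position. *)
Fixpoint deco (m n : nat) (A : fm) : fm :=
  match A with
  | Mem t u => boxn n (Mem t u)
  | Eq t u => boxn n (Eq t u)
  | And A B => And (deco m n A) (deco m n B)
  | Or A B => Or (deco m n A) (deco m n B)
  | Imp A B => Imp (deco n m A) (deco m n B)
  | All A => All (deco m n A)
  | Ex A => Ex (deco m n A)
  | Box A => deco m n A
  end.

Lemma sub_deco A : forall m n s, sub_fm s (deco m n A) = deco m n (sub_fm s A).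
Proof. induction A; simpl; intros; rewrite ?sub_boxn; simpl; congruence. Qed.

Lemma ren_deco A : forall m n r, ren_fm r (deco m n A) = deco m n (ren_fm r A).
Proof. induction A; simpl; intros; rewrite ?ren_boxn; simpl; congruence. Qed.

(** Boxes weaken an atom, so positive ones weaken the formula and negative ones strengthen it. Hence
    [deco] ascends in one count and descends in the other. *)
Lemma deco_le A : forall m n m' n',
  m' <= m -> n <= n' -> CCThm (Imp (deco m n A) (deco m' n' A)).
Proof.
  induction A; simpl; intros;
    auto using boxn_le, Imp_And, Imp_Or, Imp_Imp, Imp_All, Imp_Ex.
Qed.

Lemma asc_deco b A : asc (fun j => deco b j A).
Proof. intros j. apply deco_le; lia. Qed.

Lemma desc_deco b A : desc (fun j => deco j b A).
Proof. intros j. apply deco_le; lia. Qed.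

Lemma erase_boxn n A : erase_fm (boxn n A) = erase_fm A.
Proof. induction n; simpl; auto. Qed.

Lemma erase_deco A : forall m n, erase_fm (deco m n A) = erase_fm A.
Proof. induction A; simpl; intros; rewrite ?erase_boxn; simpl; congruence. Qed.

Lemma ren_sub_env r s A : ren_fm r (sub_fm s A) = sub_fm (ren_env r s) A.
Proof. apply ren_sub. Qed.

Lemma ren_up_sub_env r s A :
  ren_fm (up_ren r) (sub_fm (up_sub s) A) = sub_fm (up_sub (ren_env r s)) A.
Proof.
  rewrite (proj2 ren_sub). f_equal. by_cases_on_index.
  unfold ren_env. now rewrite !(proj1 ren_ren).
Qed.

Lemma inst_deco m n s A t :
  inst (deco m n (sub_fm (up_sub s) A)) t = deco m n (sub_fm (scons t s) A).
Proof. rewrite <- inst_sub_up. apply sub_deco. Qed.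

Lemma ent_extend_discharge h C G :
  ent (extend h C) G -> ent h (fun j => Imp (C j) (G j)).
Proof.
  intros [j Hj]. exists j. start. apply (der_app _ _ _ Hj), der_And; hyp.
Qed.

(** A whole tail of indices, rather than one, lets the thresholds of the two disjuncts of [Or] be
    merged at their maximum. *)
Lemma ent_extend_eventually h C G :
  desc h -> asc G -> desc C -> ent (extend h C) G ->
  exists j, forall k, j <= k -> CCThm (Imp (C k) (Imp (h k) (G k))).
Proof.
  intros Hh HG HC H. apply ent_extend_discharge in H as [j Hj]. exists j.
  intros k Hk. start. apply (der_app _ _ _ (asc_le G HG j k Hk)).
  apply (der_mp _ (C j)); [|apply (der_app _ _ _ (desc_le C HC j k Hk)); hyp].
  apply (der_app _ _ _ Hj), (der_app _ _ _ (desc_le h Hh j k Hk)); hyp.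
Qed.

(* In the case of an implication [A -> B]: the hypotheses [deco m b A], for all
   [m] at once, force [A], but a derivation from them uses a single one, since
   they descend; discharging it leaves a single decoration of [A -> B]. *)
Lemma reify_reflect b A :
  (forall g s, desc g -> forces A g s -> ent g (fun j => deco b j (sub_fm s A))) /\
  (forall g s, desc g ->
     (forall m, exists i, CCThm (Imp (g i) (deco m b (sub_fm s A)))) -> forces A g s).
Proof.
  induction A as [t u|t u|A1 [P1 Q1] A2 [P2 Q2]|A1 [P1 Q1] A2 [P2 Q2]
    |A1 [P1 Q1] A2 [P2 Q2]|A [P Q]|A [P Q]|A [P Q]]; simpl.
  (* At an atom [deco m b] is [boxn b] whatever [m] is, so [m = 0] will do. *)
  1,2: split; [auto|]; intros g s Hg H; destruct (H 0) as [i Hi];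
    apply (ent_intro _ _ i b Hg (asc_boxn _) Hi).
  - split.
    + intros g s Hg [H1 H2]. destruct (P1 g s Hg H1) as [i Hi], (P2 g s Hg H2) as [j Hj].
      apply (ent_intro _ _ (max i j) (max i j) Hg); [exact (asc_deco b (And _ _))|].
      start. apply der_And.
      * apply (der_app _ (g i)); [eapply Imp_trans; [exact Hi | apply deco_le; lia]|].
        apply (der_app _ (g (max i j))); [apply desc_le; auto; lia | hyp].
      * apply (der_app _ (g j)); [eapply Imp_trans; [exact Hj | apply deco_le; lia]|].
        apply (der_app _ (g (max i j))); [apply desc_le; auto; lia | hyp].
    + intros g s Hg H. split; [apply Q1 | apply Q2]; auto; intros m;
        destruct (H m) as [i Hi]; exists i; (eapply Imp_trans; [exact Hi|]);
        apply cc_log; constructor.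
  - split.
    + intros g s Hg H.
      (* The cover is used at the identity, with the decorated disjunction as its goal. *)
      refine (H _ g _ (arr_id g Hg) (asc_deco b (Or _ _)) _).
      simpl. intros q k Hq [Hk|Hk]; [apply P1 in Hk | apply P2 in Hk]; try apply Hq;
        destruct Hk as [j Hj]; exists j; rewrite !ren_deco, !ren_sub_env;
        (eapply Imp_trans; [exact Hj | apply cc_log; constructor]).
    + intros g s Hg H r h G Hr HG HX.
      assert (Hh : desc h) by apply Hr.
      (* Adding all decorations of one disjunct to [h] forces that disjunct, so the goal follows
         there; the added hypotheses are then discharged. *)
      assert (K : forall B, (B = A1 \/ B = A2) -> exists j, forall k, j <= k ->
        CCThm (Imp (deco k b (sub_fm (ren_env r s) B)) (Imp (h k) (G k)))).
      { intros B HB. apply (ent_extend_eventually _ _ _ Hh HG (desc_deco b (sub_fm (ren_env r s) B))).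
        specialize (HX _ _ (arr_extend h _ Hh (desc_deco b (sub_fm (ren_env r s) B)))).
        destruct HX as [j Hj].
        - destruct HB as [->| ->]; [left; apply Q1 | right; apply Q2];
            try (apply desc_extend; [assumption | apply desc_deco]);
            intros m; exists m; apply cc_log, ax_and2.
        - exists j. now rewrite (proj2 ren_id) in Hj. }
      destruct (K A1) as [j1 K1], (K A2) as [j2 K2]; auto.
      set (m := max j1 j2) in *.
      destruct (H m) as [i Hi], Hr as [_ Hr], (Hr i) as [l Hl].
      apply (ent_intro _ _ (max l m) m Hh HG).
      apply (Imp_trans _ (And (h l) (h m))).
      { start. apply der_And; (eapply der_app; [apply (desc_le h Hh _ (max l m)); lia | hyp]). }
      generalize (CCThm_ren _ Hi r); simpl; rewrite !ren_deco, !ren_sub_env; intros Hi'.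
      start. eapply der_OrE.
      * apply (der_app _ _ _ Hi'), (der_app _ _ _ Hl). eapply der_And1; hyp.
      * eapply der_mp; [apply (der_app _ _ _ (K1 m ltac:(lia))); hyp | eapply der_And2; hyp].
      * eapply der_mp; [apply (der_app _ _ _ (K2 m ltac:(lia))); hyp | eapply der_And2; hyp].
  - split.
    + intros g s Hg H.
      assert (D : desc (fun m => deco m b (sub_fm s A1))) by apply desc_deco.
      specialize (H _ _ (arr_extend g _ Hg D)). rewrite !ren_env_id in H.
      apply P2 in H; [|now apply desc_extend|].
      * exact (ent_extend_discharge _ _ _ H).
      * apply Q1; [now apply desc_extend|].
        intros m; exists m; apply cc_log, ax_and2.
    + intros g s Hg H r h Hr HA. assert (Hh : desc h) by apply Hr.
      apply P1 in HA as [j Hj]; auto. apply Q2; auto. intros m.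
      (* The antecedent is available with [j] boxes on its positive atoms and the consequent is
         wanted with [m] on its negative ones; [max j m] meets both demands. *)
      destruct (H (max j m)) as [i Hi], Hr as [_ Hr], (Hr i) as [l Hl].
      exists (max l j).
      generalize (CCThm_ren _ Hi r); simpl; rewrite !ren_deco, !ren_sub_env; intros Hi'.
      start. apply (der_app _ (deco (max j m) b (sub_fm (ren_env r s) A2))); [apply deco_le; lia|].
      eapply der_mp.
      * apply (der_app _ _ _ Hi'), (der_app _ _ _ Hl).
        eapply der_app; [apply (desc_le h Hh l (max l j)); lia | hyp].
      * eapply der_app; [apply (deco_le _ b j); lia|].
        apply (der_app _ _ _ Hj).
        eapply der_app; [apply (desc_le h Hh j (max l j)); lia | hyp].
  - split.
    + intros g s Hg H.
      (* In the lifted world variable 0 is fresh, and the extended environment is [up_sub s];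
         [cc_genR] then closes the case. *)
      specialize (H _ _ (var 0) (arr_lift g Hg)). apply P in H; [|now apply desc_lift].
      destruct H as [j Hj]. exists j. apply cc_genR, Hj.
    + intros g s Hg H r h t Hr. apply Q; [apply Hr|]. intros m.
      destruct (H m) as [i Hi], Hr as [_ Hr], (Hr i) as [l Hl]. exists l.
      eapply Imp_trans; [exact Hl|].
      eapply Imp_trans; [exact (CCThm_ren _ Hi r)|].
      simpl. rewrite ren_deco, ren_up_sub_env, <- inst_deco. apply cc_log, ax_allE.
  - split.
    + intros g s Hg H.
      refine (H _ g _ (arr_id g Hg) (asc_deco b (Ex _)) _).
      simpl. intros q k Hq [t Hk]. apply P in Hk; [|apply Hq].
      destruct Hk as [j Hj]. exists j.
      rewrite ren_deco, ren_up_sub_env, <- inst_deco in *.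
      eapply Imp_trans; [exact Hj | apply cc_log, ax_exI].
    + intros g s Hg H r h G Hr HG HX.
      assert (Hh : desc h) by apply Hr.
      (* Variable 0 of the lifted world is the generic witness, and [C] assumes the body of it.
         Since the arrow renames by [S], the goal comes back lifted, as [cc_exR] requires. *)
      set (C := fun m => deco m b (sub_fm (up_sub (ren_env r s)) A)).
      assert (HC : desc C) by apply desc_deco.
      specialize (HX _ _ (arr_comp _ _ _ _ _ (arr_lift h Hh)
        (arr_extend _ C (desc_lift h Hh) HC))).
      destruct HX as [j Hj].
      { exists (var 0). rewrite <- (ren_env_comp r S).
        apply Q; [apply desc_extend; auto using desc_lift|].
        intros m; exists m; apply cc_log, ax_and2. }
      destruct (H j) as [i Hi], Hr as [_ Hr], (Hr i) as [l Hl].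
      apply (ent_intro _ _ (max l j) j Hh HG).
      assert (HE : CCThm (Imp (Ex (C j)) (Imp (h j) (G j)))).
      { apply cc_exR. start. apply (der_app _ _ _ Hj), der_And; hyp. }
      generalize (CCThm_ren _ Hi r); simpl; rewrite ren_deco, ren_up_sub_env; intros Hi'.
      start. eapply der_mp.
      * apply (der_app _ _ _ HE), (der_app _ _ _ Hi'), (der_app _ _ _ Hl).
        eapply der_app; [apply (desc_le h Hh l (max l j)); lia | hyp].
      * eapply der_app; [apply (desc_le h Hh j (max l j)); lia | hyp].
  - auto.
Qed.

(** * Boxes commute with positive formulas *)

Definition equiv (A B : fm) : Prop := CCThm (Imp A B) /\ CCThm (Imp B A).

Lemma equiv_refl A : equiv A A.
Proof. split; apply Imp_refl. Qed.

Lemma equiv_sym A B : equiv A B -> equiv B A.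
Proof. intros []; split; auto. Qed.

Lemma equiv_trans A B C : equiv A B -> equiv B C -> equiv A C.
Proof. intros [] []; split; eauto using Imp_trans. Qed.

Lemma equiv_of_Iff A B : CCThm (Iff A B) -> equiv A B.
Proof. split; [now apply Imp_of_Iff | now apply Imp_of_Iff_sym]. Qed.

Lemma equiv_boxn n A B : equiv A B -> equiv (boxn n A) (boxn n B).
Proof. intros []; split; now apply Imp_boxn. Qed.

Lemma boxn_commute (f : fm -> fm -> fm) :
  (forall A B A' B', equiv A A' -> equiv B B' -> equiv (f A B) (f A' B')) ->
  (forall A B, equiv (Box (f A B)) (f (Box A) (Box B))) ->
  forall n A B, equiv (boxn n (f A B)) (f (boxn n A) (boxn n B)).
Proof.
  intros Hf Hb n A B. induction n; [apply equiv_refl|].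
  eapply equiv_trans; [apply (equiv_boxn 1), IHn | apply Hb].
Qed.

Lemma equiv_And A B A' B' : equiv A A' -> equiv B B' -> equiv (And A B) (And A' B').
Proof. intros [] []; split; now apply Imp_And. Qed.

Lemma equiv_Or A B A' B' : equiv A A' -> equiv B B' -> equiv (Or A B) (Or A' B').
Proof. intros [] []; split; now apply Imp_Or. Qed.

Lemma equiv_All A A' : equiv A A' -> equiv (All A) (All A').
Proof. intros []; split; now apply Imp_All. Qed.

Lemma equiv_Ex A A' : equiv A A' -> equiv (Ex A) (Ex A').
Proof. intros []; split; now apply Imp_Ex. Qed.

(** A positive formula has no atom in negative position, so [m] is arbitrary, and the axioms that
    commute [Box] with the connectives and quantifiers pull the [n] boxes outside. *)
Lemma deco_pos A : pos_fm A -> forall m n s,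
  equiv (deco m n (sub_fm s A)) (boxn n (sub_fm s A)).
Proof.
  induction A; simpl; intros HA m n s; try easy; try apply equiv_refl.
  - eapply equiv_trans; [apply equiv_And; [now apply IHA1 | now apply IHA2]|].
    apply equiv_sym, (boxn_commute And); [apply equiv_And|].
    intros; apply equiv_of_Iff, cc_nonlog, cc_and.
  - eapply equiv_trans; [apply equiv_Or; [now apply IHA1 | now apply IHA2]|].
    apply equiv_sym, (boxn_commute Or); [apply equiv_Or|].
    intros; apply equiv_of_Iff, cc_nonlog, cc_or.
  - eapply equiv_trans; [apply equiv_All; now apply IHA|].
    (* The quantifier is treated as a binary operation that ignores its second argument, filled by
       [Bot]. *)
    apply equiv_sym; refine (boxn_commute (fun A _ => All A) _ _ n _ Bot); intros;
      [now apply equiv_All | apply equiv_of_Iff, cc_nonlog, cc_all].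
  - eapply equiv_trans; [apply equiv_Ex; now apply IHA|].
    apply equiv_sym; refine (boxn_commute (fun A _ => Ex A) _ _ n _ Bot); intros;
      [now apply equiv_Ex | apply equiv_of_Iff, cc_nonlog, cc_ex].
Qed.

(** Both directions go through [reify_reflect] and [deco_pos]; for the second, the parameter [b] is
    the number [j] of boxes that the world happens to prove. *)
Lemma forces_pos A g s :
  pos_fm A -> desc g -> forces A g s <-> ent g (fun n => boxn n (sub_fm s A)).
Proof.
  intros HA Hg. split.
  - intros H. apply (proj1 (reify_reflect 0 A)) in H as [j Hj]; auto.
    exists j. eapply Imp_trans; [exact Hj | now apply deco_pos].
  - intros [j Hj]. apply (proj2 (reify_reflect j A)); auto. intros m. exists j.
    eapply Imp_trans; [exact Hj | now apply deco_pos].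
Qed.

(** * Soundness of the forcing relation *)

Lemma boxn_Bot_deco A : forall m n, CCThm (Imp (boxn n Bot) (deco m n A)).
Proof.
  assert (L : forall n, lift (boxn n Bot) = boxn n Bot)
    by (intros; unfold lift; now rewrite ren_boxn).
  assert (F : forall A, CCThm (Imp Bot A)) by (intros; apply cc_log, ax_efq).
  induction A; simpl; intros m n; auto using Imp_boxn.
  - start. apply der_And; [apply (der_app _ _ _ (IHA1 m n)) | apply (der_app _ _ _ (IHA2 m n))]; hyp.
  - start. apply der_Or1, (der_app _ _ _ (IHA1 m n)); hyp.
  - start. apply (der_app _ _ _ (IHA2 m n)); hyp.
  - apply cc_genR. rewrite L. apply IHA.
  (* The universal closure is derived first, [Bot] being closed under [lift], and then instantiated
     at variable 0 as a witness. *)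
  - start. apply (der_exI _ _ (var 0)), der_allE.
    apply (der_app _ (boxn n Bot)); [|hyp]. apply cc_genR. rewrite L. apply IHA.
Qed.

(** The world proves [boxn j Bot] for one [j], which implies every decoration with [j] boxes on the
    positive atoms. As [Bot] is closed, its environment may differ from that of [A]. *)
Lemma forces_Bot A g s q : desc g -> forces Bot g q -> forces A g s.
Proof.
  intros Hg H. apply forces_pos in H as [j Hj]; [|simpl; auto|assumption].
  apply (proj2 (reify_reflect j A)); auto. intros m. exists j.
  eapply Imp_trans; [exact Hj | apply boxn_Bot_deco].
Qed.

Lemma Eq_sym u v : CCThm (Imp (Eq u v) (Eq v u)).
Proof.
  start. apply (der_mp _ (Eq u u)); [|apply der_thm, cc_log, ax_refl].
  eapply der_app; [|hyp].
  generalize (cc_log _ (ax_leib (Eq (var 0) (ren_tm S u)) u v)).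
  unfold inst; simpl. rewrite !(proj1 sub_ren), !(proj1 sub_var). exact (fun H => H).
Qed.

Lemma comp_env_hole_ren r u q :
  ren_env r (comp_env (scons u var) q) =
  comp_env (scons (ren_tm r u) var) (ren_env (up_ren r) q).
Proof.
  apply functional_extensionality; intros n. unfold comp_env, ren_env.
  rewrite (proj1 ren_sub), (proj1 sub_ren). f_equal. by_cases_on_index.
Qed.

Lemma comp_env_hole_scons t u q :
  scons t (comp_env (scons u var) q) = comp_env (scons u var) (scons (ren_tm S t) q).
Proof.
  by_cases_on_index. unfold comp_env; simpl. rewrite (proj1 sub_ren).
  symmetry. apply sub_var.
Qed.

(* [q] is an environment with a hole, its variable 0. *)
Lemma forces_leib A : forall g u v q,
  desc g -> ent g (fun n => boxn n (Eq u v)) ->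
  forces A g (comp_env (scons u var) q) -> forces A g (comp_env (scons v var) q).
Proof.
  assert (sym : forall g u v, ent g (fun n => boxn n (Eq u v)) ->
                              ent g (fun n => boxn n (Eq v u))).
  { intros g u v [j Hj]. exists j.
    eapply Imp_trans; [exact Hj | apply Imp_boxn, Eq_sym]. }
  assert (shift : forall r g h u v, arr r g h -> ent g (fun n => boxn n (Eq u v)) ->
                    ent h (fun n => boxn n (Eq (ren_tm r u) (ren_tm r v)))).
  { intros r g h u v Hr H. destruct (ent_arr r g h _ (asc_boxn _) Hr H) as [j Hj].
    exists j. now rewrite ren_boxn in Hj. }
  assert (atom : forall P g u v q, desc g -> ent g (fun n => boxn n (Eq u v)) ->
            ent g (fun n => boxn n (sub_fm (comp_env (scons u var) q) P)) ->
            ent g (fun n => boxn n (sub_fm (comp_env (scons v var) q) P))).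
  (* The equation and the formula may carry different numbers of boxes; both are raised to the
     maximum, where Leibniz's law is applied under the boxes by [boxn_K]. *)
  { intros P g u v q Hg [i Hi] [j Hj]. exists (max i j). start.
    apply (der_mp _ (boxn (max i j) (sub_fm (comp_env (scons u var) q) P))).
    - apply (der_app _ _ _ (boxn_K _ _ _)).
      eapply der_app; [|apply (der_app _ (g i));
        [exact (Imp_trans _ _ _ Hi (boxn_le i (max i j) _ ltac:(lia)))|]].
      + apply Imp_boxn.
        generalize (cc_log _ (ax_leib (sub_fm q P) u v)).
        unfold inst. rewrite !(proj2 sub_sub). exact (fun H => H).
      + apply (der_app _ _ _ (desc_le g Hg i (max i j) ltac:(lia))); hyp.
    - apply (der_app _ _ _ (boxn_le j (max i j) _ ltac:(lia))), (der_app _ _ _ Hj).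
      apply (der_app _ _ _ (desc_le g Hg j (max i j) ltac:(lia))); hyp. }
  induction A; intros g u v q Hg Huv.
  1,2: apply atom; assumption.
  all: simpl.
  - intros []; split; eauto.
  - apply cov_impl. intros r h Hr. rewrite !comp_env_hole_ren.
    assert (desc h) by apply Hr. intros []; [left|right]; eauto.
  - intros H r h Hr. specialize (H r h Hr). revert H. rewrite !comp_env_hole_ren.
    assert (Hh : desc h) by apply Hr. apply (shift _ _ _ _ _ Hr) in Huv.
    intros H H1. apply (IHA2 _ _ _ _ Hh Huv), H. revert H1.
    apply (IHA1 _ _ _ _ Hh), sym, Huv.
  - intros H r h t Hr. specialize (H r h t Hr). revert H.
    rewrite !comp_env_hole_ren, !comp_env_hole_scons.
    assert (desc h) by apply Hr. eauto.
  - apply cov_impl. intros r h Hr [t H]. exists t. revert H.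
    rewrite !comp_env_hole_ren, !comp_env_hole_scons.
    assert (desc h) by apply Hr. eauto.
  - eauto.
Qed.

Lemma comp_env_up u s : comp_env (scons u var) (up_sub s) = scons u s.
Proof.
  rewrite comp_env_scons. f_equal.
  apply functional_extensionality; intros n. apply sub_var.
Qed.

Lemma forces_LogAx A g s : LogAx A -> desc g -> forces A g s.
Proof.
  destruct 1; intros Hg; simpl.
  - intros r h Hr HA q k Hq _. eapply forces_arr; eassumption.
  - intros r h Hr H1 q k Hq H2 p l Hp H3.
    assert (Hl : desc l) by apply Hp.
    specialize (H2 p l Hp H3).
    specialize (H1 _ l (arr_comp _ _ _ _ _ Hq Hp)). rewrite <- (ren_env_comp q p) in H1.
    specialize (H1 H3 _ l (arr_id l Hl)). rewrite !ren_env_id in H1. auto.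
  - tauto.
  - tauto.
  - intros r h Hr HA q k Hq HB. split; [eapply forces_arr; eassumption | assumption].
  - intros r h Hr HA. apply cov_unit. intros q k Hq. left. eapply forces_arr; eassumption.
  - intros r h Hr HB. apply cov_unit. intros q k Hq. right. eapply forces_arr; eassumption.
  - intros r h Hr H1 q k Hq H2 p l Hp H3.
    (* By locality of the conclusion the case distinction may be made on the cover. *)
    apply forces_cov; [apply Hp|]. revert H3. apply cov_impl. intros r' h' Hr' [H|H].
    + specialize (H1 _ h' (arr_comp _ _ _ _ _ (arr_comp _ _ _ _ _ Hq Hp) Hr')).
      rewrite <- (ren_env_comp (fun n => p (q n)) r'), <- (ren_env_comp q p) in H1. auto.
    + specialize (H2 _ h' (arr_comp _ _ _ _ _ Hp Hr')).
      rewrite <- (ren_env_comp p r') in H2. auto.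
  - intros r h Hr H. apply (forces_Bot _ _ _ (ren_env r s)); [apply Hr | exact H].
  - intros r h Hr H. apply forces_inst.
    specialize (H _ h (sub_tm (ren_env r s) t) (arr_id h (proj1 Hr))).
    now rewrite ren_env_id in H.
  - intros r h Hr H. apply cov_unit. intros q k Hq.
    exists (sub_tm (ren_env q (ren_env r s)) t). apply forces_inst.
    eapply forces_arr; eassumption.
  - exists 0. apply Imp_weaken, cc_log, ax_refl.
  - intros r h Hr H q k Hq H1. apply forces_inst. rewrite <- comp_env_up.
    apply forces_inst in H1. rewrite <- comp_env_up in H1.
    revert H1. apply forces_leib; [apply Hq|].
    destruct (ent_arr q h k _ (asc_boxn _) Hq H) as [j Hj]. exists j.
    rewrite ren_boxn in Hj. simpl in Hj. now rewrite !(proj1 ren_sub) in Hj.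
Qed.

Lemma comprehension_boxn n A s t :
  equiv (boxn n (Mem t (cmp (sub_fm (up_sub s) A)))) (boxn (S n) (sub_fm (scons t s) A)).
Proof.
  rewrite <- Nat.add_1_r, boxn_add, <- inst_sub_up.
  apply equiv_boxn, equiv_of_Iff, comprehension_term.
Qed.

Lemma forces_comprehension A n g s :
  pos_fm A -> forces (Iff (Mem (var n) (cmp A)) (inst A (var n))) g s.
Proof.
  intros HA. split; intros r h Hr H.
  - apply forces_inst, forces_pos; [assumption | apply Hr|].
    destruct H as [j Hj]. apply (ent_intro _ _ j (S j)); [apply Hr | apply asc_boxn|].
    eapply Imp_trans; [exact Hj | apply comprehension_boxn].
  - apply forces_inst, forces_pos in H as [j Hj]; [|assumption | apply Hr].
    exists j. eapply Imp_trans; [exact Hj|].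
    (* [comprehension_boxn] can be read backwards only from a successor number of boxes, so one box
       is added first. *)
    eapply Imp_trans; [apply (boxn_le j (S j)); lia | apply comprehension_boxn].
Qed.

(** The first term contains every set, in particular [cmp Bot]. By Leibniz [cmp Bot] is then a
    member of itself, which means [Box Bot]. *)
Lemma universe_eq_empty :
  CCThm (Imp (Eq (cmp (Eq (var 0) (var 0))) (cmp Bot)) (Box Bot)).
Proof.
  start. apply (der_app _ (Mem (cmp Bot) (cmp Bot))).
  { apply Imp_of_Iff, (comprehension_term Bot). }
  apply (der_mp _ (Mem (cmp Bot) (cmp (Eq (var 0) (var 0))))).
  - eapply der_app; [|hyp]. apply cc_log, (ax_leib (Mem (cmp Bot) (var 0))).
  - apply der_thm. eapply cc_mp.
    { apply Imp_of_Iff_sym, (comprehension_term (Eq (var 0) (var 0))). }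
    eapply cc_mp; [apply cc_nonlog, cc_box | apply cc_log, ax_refl].
Qed.

Lemma forces_two_sets g s : forces (Ex (Ex (Neg (Eq (var 1) (var 0))))) g s.
Proof.
  apply cov_unit. intros r h Hr. exists (cmp (Eq (var 0) (var 0))).
  apply cov_unit. intros q k Hq. exists (cmp Bot).
  intros p l Hp [j Hj]. apply (forces_pos Bot); [simpl; auto | apply Hp|].
  apply (ent_intro _ _ j (j + 1)); [apply Hp | apply asc_boxn|].
  rewrite boxn_add. eapply Imp_trans; [exact Hj | apply Imp_boxn, universe_eq_empty].
Qed.

Lemma forces_PFThm A : PFThm A -> forall g s, desc g -> forces A g s.
Proof.
  induction 1 as [A HA _|A HA _|A B _ IH1 _ IH2|C A _ IH|C A _ IH]; intros g s Hg.
  - now apply forces_LogAx.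
  - destruct HA; [now apply forces_comprehension | apply forces_two_sets].
  (* Modus ponens is the clause for [Imp] at the identity arrow. *)
  - specialize (IH1 g s Hg _ g (arr_id g Hg)). rewrite ren_env_id in IH1.
    apply IH1, IH2, Hg.
  - intros r h Hr HC q k t Hq. assert (Hk : desc k) by apply Hq.
    specialize (IH k (scons t (ren_env q (ren_env r s))) Hk _ k (arr_id k Hk)).
    rewrite ren_env_id in IH. apply IH, forces_lift. eapply forces_arr; eassumption.
  - intros r h Hr HE. apply forces_cov; [apply Hr|].
    revert HE. apply cov_impl. intros q k Hq [t Ht]. assert (Hk : desc k) by apply Hq.
    specialize (IH k (scons t (ren_env q (ren_env r s))) Hk _ k (arr_id k Hk)).
    rewrite ren_env_id in IH. apply IH, forces_lift in Ht. exact Ht.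
Qed.

(** * Erasure and extraction of the decoration *)

Lemma erase_pf :
  (forall t, pf_tm t -> erase_tm t = t) /\
  (forall A, (pos_fm A -> erase_fm A = A) /\ (pf_fm A -> erase_fm A = A)).
Proof.
  apply tm_fm_mutind; simpl; intuition (f_equal; auto).
Qed.

Lemma pf_ren :
  (forall t r, pf_tm (ren_tm r t) <-> pf_tm t) /\
  (forall A r, (pos_fm (ren_fm r A) <-> pos_fm A) /\ (pf_fm (ren_fm r A) <-> pf_fm A)).
Proof.
  apply tm_fm_mutind; simpl; intros;
    repeat match goal with
    | IH : forall r, @?P r /\ @?Q r |- _ =>
        pose proof (fun r => proj1 (IH r)); pose proof (fun r => proj2 (IH r)); clear IH
    end;
    repeat match goal with
    | IH : forall _, _ <-> _ |- _ => rewrite ?IH; clear IH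
    end; tauto.
Qed.

(** Every theorem stays in the box-free language, so by [erase_pf] erasing its decoration gives back
    the theorem itself. *)
Lemma PFThm_pf A : PFThm A -> pf_fm A.
Proof.
  assert (L : forall C, pf_fm (lift C) -> pf_fm C) by (intros C; apply pf_ren).
  induction 1; simpl in *; intuition.
Qed.

Theorem theorem6p1 :
  forall phi : fm, PFThm phi -> exists psi : fm, CCThm psi /\ erase_fm psi = phi.
Proof.
  intros phi H.
  (* A constant provable sequence is the world whose theory is CC' itself. *)
  set (top := fun _ : nat => Imp Bot Bot).
  assert (Ht : desc top) by (intros j; apply Imp_refl).
  destruct (proj1 (reify_reflect 0 phi) top var Ht (forces_PFThm phi H top var Ht)) as [j Hj].
  rewrite (proj2 sub_var) in Hj. exists (deco 0 j phi). split.
  - exact (cc_mp _ _ Hj (Imp_refl Bot)).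
  - rewrite erase_deco. now apply erase_pf, PFThm_pf.
Qed.
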